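(* Let $S$ be a Hausdorff space and let $(\Phi,\|\cdot\|_\Phi)$ be a Banach space of real-valued functions defined on $S$. Let $K$ be a nonempty compact metrizable $\Phi$-convex subset of $S$ and suppose that: (1) the restriction of each $\varphi\in\Phi$ to $K$ is continuous, and there exists a real number $\alpha_K\ge 0$ such that $\alpha_K\|\varphi\|_\Phi\ge \sup_{x\in K}|\varphi(x)|$ for all $\varphi\in\Phi$; (2) $\Phi$ separates the points of $K$. Then: (i) $\Phi\mathrm{Exp}(K)\neq\emptyset$, and the set of all $\varphi\in\Phi$ that $\Phi$-expose $K$ at some point contains a dense $G_\delta$ subset of $(\Phi,\|\cdot\|_\Phi)$; (ii) $K=\mathrm{conv}_\Phi(\Phi\mathrm{Exp}(K))$.
   Context: A Banach space of real-valued functions on $S$ is a real vector space of functions $S\to\mathbb{R}$ (pointwise operations) with a complete norm. A subset $X\subseteq S$ is $\Phi$-convex if $X=S$ or there exist a nonempty set $I$, functions $\varphi_i\in\Phi$ and numbers $\lambda_i\in\mathbb{R}$ ($i\in I$) with $X=\bigcap_{i\in I}\{x\in S:\varphi_i(x)\le\lambda_i\}$. For a nonempty $A\subseteq S$, the $\Phi$-convex hull $\mathrm{conv}_\Phi(A)$ is the intersection of all $\Phi$-convex subsets of $S$ containing $A$. For a nonempty $C\subseteq S$, a function $\varphi\in\Phi$ $\Phi$-exposes $C$ at $x\in C$ if $\varphi(x)>\varphi(y)$ for all $y\in C\setminus\{x\}$; a point $x\in C$ is $\Phi$-exposed in $C$ if some $\varphi\in\Phi$ $\Phi$-exposes $C$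 at $x$, and $\Phi\mathrm{Exp}(C)$ is the set of all such points. $\Phi$ separates the points of $K$ if for all $x\ne y$ in $K$ there is $\varphi\in\Phi$ with $\varphi(x)\ne\varphi(y)$. *)

(* Defs.v *)
From HB Require Import structures.
From mathcomp Require Import all_boot all_order all_algebra.
From mathcomp Require Import all_classical all_reals all_analysis.

Set Implicit Arguments.
Unset Strict Implicit.
Unset Printing Implicit Defensive.

Import Order.TTheory GRing.Theory Num.Theory.
Import numFieldNormedType.Exports.

Local Open Scope classical_set_scope.
Local Open Scope ring_scope.

(* A linear space of functions S -> R with pointwise operations and a complete
   norm, encoded as a complete normed module together with a linear injection
   [fval] into the module S -> R of all functions: the elements of the Banach
   space are identified with the functions [fval phi].  The norm (hence the
   topology) is that of the carrier and need not be related to S. *)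
Record banachFunSpace (R : realType) (S : Type) := BanachFunSpace {
  bfs_carrier :> completeNormedModType R;
  fval : {linear bfs_carrier -> (S -> R^o)};
  fval_inj : injective fval }.

Arguments fval {R S b}.
Arguments fval_inj {R S b}.

Definition metrizable (R : realType) (T : topologicalType) : Prop :=
  exists d : T -> T -> R,
    [/\ forall x y, 0 <= d x y,
        forall x y, d x y = 0 <-> x = y,
        forall x y, d x y = d y x,
        forall x y z, d x z <= d x y + d y z
      & forall x, nbhs x =
          filter_from [set e : R | 0 < e] (fun e => [set y | d x y < e])].

Section phi_convexity.
Context (R : realType) (S : Type) (Phi : banachFunSpace R S).

Definition Phi_convex (X : set S) : Prop :=
  X = setT \/
  exists (I : Type) (phi : I -> Phi) (lambda : I -> R),
    inhabited I /\
    X = \bigcap_(i in [set: I]) [set x | fval (phi i) x <= lambda i].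

Definition Phi_conv (A : set S) : set S :=
  \bigcap_(X in [set X | Phi_convex X /\ A `<=` X]) X.

Definition exposes_at (phi : Phi) (C : set S) (x : S) : Prop :=
  C x /\ forall y, (C `\ x) y -> fval phi y < fval phi x.

Definition PhiExp (C : set S) : set S :=
  [set x | exists phi : Phi, exposes_at phi C x].

Definition exposing (C : set S) : set Phi :=
  [set phi | exists x, exposes_at phi C x].

Definition separates_points (K : set S) : Prop :=
  forall x y, K x -> K y -> x <> y -> exists phi : Phi, fval phi x <> fval phi y.

End phi_convexity.

Arguments Phi_convex {R S} Phi X.
Arguments Phi_conv {R S} Phi A.
Arguments PhiExp {R S} Phi C.
Arguments exposing {R S} Phi C.
Arguments separates_points {R S} Phi K.

(* Main.v *)
Require Import Defs.
From HB Require Import structures.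
From mathcomp Require Import all_boot all_order all_algebra.
From mathcomp Require Import all_classical all_reals all_analysis.
From mathcomp Require Import borel_hierarchy.
From mathcomp Require Import lra.

Set Implicit Arguments.
Unset Strict Implicit.
Unset Printing Implicit Defensive.

Import Order.TTheory GRing.Theory Num.Theory.
Import numFieldNormedType.Exports.

Local Open Scope classical_set_scope.
Local Open Scope ring_scope.

(** The support function p(phi) = max of phi over K is convex and Lipschitz on
    Phi.  If two points x, y of K both maximise phi, then evaluation at x and evaluation at y
    both support p from below at phi, so for every psi and t > 0
        p(phi + t psi) + p(phi - t psi) - 2 p(phi) >= t (psi(x) - psi(y)).
    Hence, if p is differentiable at phi in the direction psi, then psi takes the
    same value at all the maximisers of phi ([flat_maximizers]).  When this holds
    for every psi in a family separating the points of K, the maximiser is unique,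
    that is, phi exposes K ([flat_exposing]).

    A countable such family is enough, and one exists because K is compact and
    metrizable: for each n, finitely many functions separate all the pairs at
    distance at least 1/n ([countable_separating_subfamily]).

    Differentiability in the direction psi is an intersection over k of the sets
    where the symmetric second difference of p along psi is smaller than t/k for
    some t > 0.  These sets are open since p is continuous ([open_flat_along]),
    and dense since otherwise the slope of p would grow at a definite rate along a
    whole segment however finely it is subdivided, against the Lipschitz bound
    ([dense_flat_along]).  Baire's theorem makes the countable intersection of
    these sets a dense G_delta set of exposing functions.

    For the second part, suppose that x in K is cut off from the exposed points:
    phi(x) > l while phi <= l at each of them.  A small perturbation psi of phi
    exposes K at some z, and psi(x) <= psi(z) gives phi(x) <= l up to an
    arbitrarily small error, a contradiction ([subset_Phi_conv_exposed]). *)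

(** * Second differences of Lipschitz functions *)

Section second_difference.
Context {R : realType} {E : normedModType R}.
Implicit Types (f : E -> R) (u v : E).

(** For convex f, u lies in this set exactly when the right and left derivatives
    of f at u in the direction v differ by less than e; the intersection over
    e > 0 is then the set of points of differentiability along v. *)
Definition flat_along f v (e : R) : set E :=
  [set u | exists2 t : R, 0 < t &
    f (u + t *: v) + f (u - t *: v) - 2 * f u < e * t].

Lemma open_flat_along f v e : continuous f -> open (flat_along f v e).
Proof.
move=> fcont.
have -> : flat_along f v e = \bigcup_(t in [set t : R | 0 < t])
    ((fun u => f (u + t *: v) + f (u - t *: v) - 2 * f u) @^-1`
       [set r | r < e * t]).
  by apply/seteqP; split=> u [t t0 ut]; exists t.
apply: bigcup_open => t _; apply: open_comp; last exact: open_lt.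
have shift w : continuous (fun u => f (u + w)).
  move=> u; apply: continuous_comp; last exact: fcont.
  by apply: cvgD; [exact: cvg_id|exact: cvg_cst].
move=> u _; apply: cvgB; first by apply: cvgD; exact: shift.
by apply: cvgMr; exact: fcont.
Qed.

Lemma lipschitz_continuous f (a : R) :
  (forall u v, f u - f v <= a * `|u - v|) -> continuous f.
Proof.
move=> flip u; apply/cvgrPdist_le => e e0.
have a1 : 0 < `|a| + 1 by rewrite ltr_wpDl.
near=> w.
have uw : `|u - w| <= e / (`|a| + 1).
  by near: w; apply: cvgr_dist_le; [exact: cvg_id|exact: divr_gt0].
have bound x y : `|x - y| <= e / (`|a| + 1) -> f x - f y <= e.
  move=> xy; apply: le_trans (flip x y) _.
  rewrite (le_trans (ler_wpM2r _ (ler_norm a))) //.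
  apply: (@le_trans _ _ ((`|a| + 1) * `|x - y|)).
    by rewrite ler_wpM2r// lerDl.
  by rewrite mulrC -ler_pdivlMr.
by rewrite ler_norml lerNl opprB !bound// distrC.
Unshelve. all: by end_near. Qed.

(** If no point of an open set were flat, the slopes of f over consecutive steps
    of length t along a segment in direction v would increase by at least e t at
    each step.  After N steps, with N t fixed, the increase e N t exceeds
    2 a t |v|, the largest difference of slopes that the Lipschitz constant a
    allows, once N is large. *)
Lemma dense_flat_along f v (a e : R) :
  (forall u v, f u - f v <= a * `|u - v|) -> 0 < e -> dense (flat_along f v e).
Proof.
move=> flip e0 O [u Ou] oO.
have /nbhs_ballP[r /= r0 ballO] : nbhs u O by apply: open_nbhs_nbhs.
apply: contrapT => /forallNP noflat.
have v1 : 0 < `|v| + 1 by rewrite ltr_wpDl.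
(* N steps of length t span the length r / (|v| + 1), so the segment stays in the
   ball of radius r whatever v is. *)
pose N := (Num.truncn (2 * a * `|v| / e)).+1.
have NP : 2 * a * `|v| < N%:R * e by rewrite -ltr_pdivrMr // truncnS_gt.
pose t := r / (`|v| + 1) / N%:R.
have t0 : 0 < t by rewrite !divr_gt0.
pose slope k := f (u + (t *+ k.+1) *: v) - f (u + (t *+ k) *: v).
have inO k : (k <= N)%N -> O (u + (t *+ k) *: v).
  move=> kN; apply: ballO; rewrite -ball_normE /= opprD addrA subrr sub0r normrN.
  rewrite normrZ ger0_norm ?mulrn_wge0 1?ltW//.
  apply: (@le_lt_trans _ _ (t *+ N * `|v|)).
    by rewrite ler_wpM2r // ler_wpMn2l // ltW.
  rewrite /t -mulr_natr divfK ?pnatr_eq0// mulrAC ltr_pdivrMr//.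
  by rewrite ltr_pM2l// ltrDl.
have slopeS k : (k < N)%N -> slope k + e * t <= slope k.+1.
  move=> kN; have := noflat (u + (t *+ k.+1) *: v).
  move/not_andP => [/(_ (inO _ kN))//|].
  move=> /forall2NP/(_ t)[//|/negP]; rewrite -leNgt => H.
  have e1 : u + (t *+ k.+1) *: v + t *: v = u + (t *+ k.+2) *: v.
    by rewrite -addrA -scalerDl -mulrSr.
  have e2 : u + (t *+ k.+1) *: v - t *: v = u + (t *+ k) *: v.
    by rewrite mulrSr scalerDl addrA addrK.
  move: H; rewrite e1 e2 /slope; lra.
have slopeN k : (k <= N)%N -> slope 0%N + (e * t) *+ k <= slope k.
  elim: k => [_|k IH kN]; first by rewrite mulr0n addr0.
  apply: le_trans (slopeS _ kN); rewrite mulrSr addrA lerD2r; exact/IH/ltnW.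
have step k : `|t *+ k.+1 *: v - t *+ k *: v| = t * `|v|.
  by rewrite -scalerBl mulrSr addrAC subrr add0r normrZ ger0_norm// ltW.
have slope_le : slope N <= a * (t * `|v|).
  rewrite -(step N); apply: le_trans (flip _ _) _.
  by rewrite opprD addrACA subrr add0r.
have slope_ge : - (a * (t * `|v|)) <= slope 0%N.
  rewrite lerNl opprB -(step 0%N); apply: le_trans (flip _ _) _.
  by rewrite opprD addrACA subrr add0r distrC.
have := le_trans (lerD slope_ge (lexx _)) (le_trans (slopeN N (leqnn N)) slope_le).
rewrite -mulr_natl => H.
have : t * (N%:R * e) <= t * (2 * a * `|v|) by lra.
by rewrite ler_pM2l// leNgt NP.
Qed.

End second_difference.

(** * Countable separating families on compact metrizable spaces *)
Lemma compact_set_type (T : topologicalType) (A : set T) :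
  compact A -> compact [set: set_type A].
Proof.
move=> cA F PF _.
have [|p [Ap clp]] := cA (set_val @ F) _.
  apply: (@filterS _ F _ setT); last exact: filterT.
  by move=> x _; exact: set_valP.
exists (SigSub (mem_set Ap)); split=> // B C FB [_ [[W oW <-] /= Wp] WC].
have [||_ [[x Bx <-] Wx]] := clp (set_val @` B) W.
- by apply: (@filterS _ F _ B) => // x Bx; exists x.
- by apply: open_nbhs_nbhs; split.
by exists x; split=> //; exact: WC.
Qed.

(** For e > 0, the pairs (x, y) with x <> y have neighbourhoods separated by a
    single f i, and the diagonal pairs have neighbourhoods of pairs at distance
    less than e; compactness of T * T then leaves finitely many indices i that
    handle all pairs at distance at least e.  Letting e run through the 1/(n+1)
    gives a countable family. *)
Lemma countable_separating_subfamily (R : realType) (T : topologicalType)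
    (I : choiceType) (f : I -> T -> R) (i0 : I) :
  metrizable R T -> compact [set: T] -> (forall i, continuous (f i)) ->
  (forall x y, x <> y -> exists i, f i x <> f i y) ->
  exists g : nat -> I, forall x y, x <> y -> exists n, f (g n) x <> f (g n) y.
Proof.
move=> [d [d_ge0 d0 dC dT nbhsE]] cT fcont fsep.
have fin_sep (e : R) : 0 < e -> exists s : seq I, forall x y,
    d x y < e \/ exists2 i, i \in s & f i x <> f i y.
  move=> e0.
  pose Q (s : seq I) (z : T * T) :=
    d z.1 z.2 < e \/ exists2 i, i \in s & f i z.1 <> f i z.2.
  pose F : set_system (seq I) :=
    filter_from [set: seq I] (fun s0 => [set s | {subset s0 <= s}]).
  have FF : Filter F.
    apply: filter_from_filter; first by exists [::].
    move=> s1 s2 _ _; exists (s1 ++ s2) => // s ss; split=> i si;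
      by apply: ss; rewrite mem_cat si ?orbT.
  (* Covering compactness is applied along the filter of finite sets of indices
     ordered by inclusion: a finite subcover is a property that holds from some
     finite set on. *)
  have cTT : compact [set: T * T] by rewrite -setXTT; exact: compact_setX.
  have /= [|s _ sQ] := (compact_near_coveringP _).1 cTT _ F Q FF.
    move=> [x y] _; have [<-|xy] := pselect (x = y).
      exists ([set z | d x z.1 < e / 2 /\ d x z.2 < e / 2], setT) => /=.
        split; last exact: filterT.
        exists ([set z | d x z < e / 2], [set z | d x z < e / 2]) => //=.
        by split; rewrite nbhsE; exists (e / 2) => //=; rewrite divr_gt0.
      move=> [[u v] s] /= [[xu xv] _]; left => /=.
      apply: le_lt_trans (dT u x v) _; rewrite dC [e]splitr; exact: ltrD.
    have [i fi] := fsep _ _ xy.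
    exists ([set z | f i z.1 - f i z.2 != 0], [set s | i \in s]) => /=.
      split; last by exists [:: i] => // s; apply; rewrite inE.
      have : (fun z : T * T => f i z.1 - f i z.2) @ (x, y) --> f i x - f i y.
        apply: cvgB.
          by apply: continuous_comp; [exact: cvg_fst|exact: fcont].
        by apply: continuous_comp; [exact: cvg_snd|exact: fcont].
      by move/cvgr_neq0; apply; rewrite subr_eq0; apply/eqP.
    move=> [[u v] s] /= [+ si]; rewrite subr_eq0 => /eqP fuv.
    by right; exists i.
  by exists s => x y; exact: (sQ s _ (x, y)).
have /choice[s sP] : forall n : nat, exists s : seq I, forall x y,
    d x y < n.+1%:R^-1 \/ exists2 i, i \in s & f i x <> f i y.
  by move=> n; apply: fin_sep; rewrite invr_gt0.
pose g (m : nat) : I :=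
  let nk := odflt (0%N, 0%N) (unpickle m) in nth i0 (s nk.1) nk.2.
exists g => x y xy.
have dxy : 0 < d x y.
  by rewrite lt_neqAle d_ge0 andbT eq_sym; apply/eqP => /d0.
have [n] := ltr_add_invr dxy; rewrite add0r => nxy.
have [dn|[i si fi]] := sP n x y; first by have := lt_trans nxy dn; rewrite ltxx.
exists (pickle (n, index i (s n))).
by rewrite /g pickleK /= nth_index.
Qed.

(** * The support function of K and its exposing functions *)

Section support_functional.
Context {R : realType} {S : topologicalType} (Phi : banachFunSpace R S).
Context (K : set S) (a : R).
Context (K0 : K !=set0) (cK : compact K).
Context (fval_continuous :
  forall phi : Phi, {within K, continuous (fval phi : S -> R)}).
Context (fval_le :
  forall (phi : Phi) x, K x -> `|fval phi x : R| <= a * `|phi|).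
Implicit Types (phi psi : Phi) (x y : S).

Definition support_fun phi : R := sup [set (fval phi x : R) | x in K].

Lemma support_fun_ub phi x : K x -> fval phi x <= support_fun phi.
Proof.
move=> Kx; apply: ub_le_sup; last by exists x.
exists (a * `|phi|) => _ [y Ky <-].
exact: le_trans (ler_norm _) (fval_le _ Ky).
Qed.

Lemma support_fun_attained phi : exists2 x, K x & fval phi x = support_fun phi.
Proof.
have [x /set_mem Kx xmax] := compact_EVT_max K0 cK (@fval_continuous phi).
exists x => //; apply/eqP; rewrite eq_le support_fun_ub//=.
apply: ge_sup; first exact: image_nonempty.
by move=> _ [y /mem_set Ky <-]; exact: xmax.
Qed.

Lemma fval_dist phi psi x : K x ->
  (fval phi x : R) - fval psi x <= a * `|phi - psi|.
Proof.
by move=> /(@fval_le (phi - psi)); rewrite linearB => /(le_trans (ler_norm _)).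
Qed.

Lemma support_fun_lipschitz phi psi :
  support_fun phi - support_fun psi <= a * `|phi - psi|.
Proof.
have [x Kx <-] := support_fun_attained phi.
by apply: le_trans (fval_dist phi psi Kx); rewrite lerD2l lerN2 support_fun_ub.
Qed.

(** Evaluation at a maximiser of phi supports the support function at phi.  Using
    x for the increment t psi and y for the increment - t psi bounds the second
    difference below by t (psi(x) - psi(y)). *)
Lemma flat_maximizers phi psi e x y : K x -> K y ->
  fval phi x = support_fun phi -> fval phi y = support_fun phi ->
  flat_along support_fun psi e phi -> (fval psi x : R) - fval psi y < e.
Proof.
move=> Kx Ky phix phiy [t t0].
have := support_fun_ub (phi + t *: psi) Kx.
have := support_fun_ub (phi - t *: psi) Ky.
have -> : (fval (phi - t *: psi) y : R) = fval phi y - t * fval psi y.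
  by rewrite linearB linearZ.
have -> : (fval (phi + t *: psi) x : R) = fval phi x + t * fval psi x.
  by rewrite linearD linearZ.
move=> Hy Hx H.
rewrite -(ltr_pM2l t0) [t * e]mulrC.
apply: le_lt_trans H; move: Hx Hy; rewrite phix phiy; lra.
Qed.

(** All the g n are constant on the set of maximisers of phi, hence this set is a
    single point. *)
Lemma flat_exposing phi (g : nat -> Phi) :
  (forall x y, K x -> K y -> x <> y ->
    exists n, fval (g n) x <> fval (g n) y) ->
  (forall n k : nat, flat_along support_fun (g n) k.+1%:R^-1 phi) ->
  exposing Phi K phi.
Proof.
move=> gsep gflat; have [x Kx phix] := support_fun_attained phi.
exists x; split=> // y [Ky /= yx].
rewrite lt_neqAle phix support_fun_ub// andbT; apply/eqP => phiy.
have [n] := gsep _ _ Kx Ky (nesym yx); apply.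
have gle u w : K u -> K w -> fval phi u = support_fun phi ->
    fval phi w = support_fun phi -> (fval (g n) u : R) <= fval (g n) w.
  move=> Ku Kw phiu phiw; rewrite leNgt; apply/negP => lt_wu.
  have [k] := ltr_add_invr lt_wu; apply/negP; rewrite -leNgt -lerBlDl.
  by have /ltW := flat_maximizers Ku Kw phiu phiw (gflat n k).
by apply/eqP; rewrite eq_le !gle.
Qed.

(** An inequality phi <= l valid at the exposed points holds on all of K: phi is a
    limit of functions that attain their maximum over K at an exposed point. *)
Lemma subset_Phi_conv_exposed :
  dense (exposing Phi K) -> K `<=` Phi_conv Phi (PhiExp Phi K).
Proof.
move=> dexp x Kx _ [[->//|[I [phi [l [_ ->]]]]] expl] i _ /=.
rewrite leNgt; apply/negP => lx.
(* The error e is made twice: at x and at the point exposed by psi. *)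
pose e := (fval (phi i) x - l i) / 2.
have e0 : 0 < e by rewrite divr_gt0 ?subr_gt0.
have a1 : 0 < `|a| + 1 by rewrite ltr_wpDl.
have [psi [psi_near [z psiz]]] :
    ball (phi i) (e / (`|a| + 1)) `&` exposing Phi K !=set0.
  apply: dexp; last exact: ball_open.
  by exists (phi i); apply: ballxx; rewrite divr_gt0.
have Kz := psiz.1.
have small : a * `|phi i - psi| < e.
  apply: le_lt_trans (ler_wpM2r _ (ler_norm a)) _ => //.
  apply: (@le_lt_trans _ _ ((`|a| + 1) * `|phi i - psi|)).
    by rewrite ler_wpM2r// lerDl.
  by rewrite mulrC -ltr_pdivlMr//; move: psi_near; rewrite -ball_normE.
have phix := le_lt_trans (fval_dist (phi i) psi Kx) small.
have phiz := fval_dist psi (phi i) Kz; rewrite distrC in phiz.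
have {}phiz := le_lt_trans phiz small.
have zl : fval (phi i) z <= l i by apply: (expl z) => //; exists psi.
have xz : fval psi x <= fval psi z.
  have [<-//|xz] := pselect (x = z).
  by apply/ltW/psiz.2; split.
move: phix phiz zl xz e0; rewrite /e; lra.
Qed.

End support_functional.

(** * Density of exposing functions and the hull of the exposed points *)

Lemma Phi_conv_subset (R : realType) (S : Type) (Phi : banachFunSpace R S)
  (A C : set S) : Phi_convex Phi C -> A `<=` C -> Phi_conv Phi A `<=` C.
Proof. by move=> cC AC x; apply. Qed.

Theorem theorem2 (R : realType) (S : topologicalType)
    (hS : hausdorff_space S) (Phi : banachFunSpace R S) (K : set S)
    (K0 : K !=set0) (Kcompact : compact K)
    (Kmetrizable : metrizable R (set_type K))
    (Kconvex : Phi_convex Phi K)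
    (Phi_continuous :
      forall phi : Phi, {within K, continuous (fval phi : S -> R)})
    (Phi_bounded : exists2 alpha : R, 0 <= alpha &
      forall phi : Phi,
        (ereal_sup [set (`|(fval phi x : R)|)%:E | x in K]
           <= (alpha * `|phi|)%:E)%E)
    (Phi_separates : separates_points Phi K) :
  (PhiExp Phi K !=set0 /\
   exists G : set Phi,
     [/\ Gdelta G, dense G & G `<=` exposing Phi K]) /\
  K = Phi_conv Phi (PhiExp Phi K).
Proof.
have [a _ Phi_sup] := Phi_bounded.
have Phi_le (phi : Phi) x : K x -> `|fval phi x : R| <= a * `|phi|.
  move=> Kx; rewrite -lee_fin; apply: le_trans (Phi_sup phi).
  by apply: ereal_sup_ubound; exists x.
have [g gsep] : exists g : nat -> Phi, forall x y : set_type K, x <> y ->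
    exists n, fval (g n) (set_val x) <> fval (g n) (set_val y).
  apply: (@countable_separating_subfamily R _ Phi
    (fun phi x => fval phi (set_val x))) => //.
  - exact: 0.
  - exact: compact_set_type.
  - by move=> phi; apply/subspace_sigL_continuousP.
  - move=> x y xy; apply: Phi_separates; [exact: set_valP|exact: set_valP|].
    by move/val_inj.
have {}gsep x y : K x -> K y -> x <> y ->
    exists n, fval (g n) x <> fval (g n) y.
  move=> Kx Ky xy; apply: (gsep (SigSub (mem_set Kx)) (SigSub (mem_set Ky))).
  by case.
pose p := support_fun (Phi := Phi) K.
have plip := support_fun_lipschitz K0 Kcompact Phi_continuous Phi_le.
(* The sets for all pairs (n, k) are listed as one sequence; the default pair is
   used for the codes of no pair and only repeats one of the sets. *)
pose D m := let nk := odflt (0%N, 0%N) (unpickle m) in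
  flat_along p (g nk.1) nk.2.+1%:R^-1.
have oD m : open (D m).
  by apply: open_flat_along; exact: lipschitz_continuous plip.
have dD m : dense (D m) by apply: dense_flat_along plip _; rewrite invr_gt0.
have dG : dense (\bigcap_m D m) by apply: Baire.
have GE : \bigcap_m D m `<=` exposing Phi K.
  move=> phi Dphi; apply: (flat_exposing K0 Kcompact Phi_continuous Phi_le gsep).
  by move=> n k; have := Dphi (pickle (n, k)) I; rewrite /D pickleK.
have dE : dense (exposing Phi K).
  by move=> O O0 /(dG _ O0)[phi [Ophi /GE]]; exists phi.
split; last first.
  apply/seteqP; split; first exact: subset_Phi_conv_exposed Phi_le dE.
  by apply: Phi_conv_subset => // x [phi []].
split; last by exists (\bigcap_m D m); split => //; exists D.
have [|phi [_ [x phix]]] := dE setT _ openT; first by exists 0.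
by exists x, phi.
Qed.
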